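(* The contravariant functor $(-)^\star:\mathsf{Sh}(\mathsf{LPS})\to\mathsf{SDL}$ is essentially surjective; that is, every left-handed strongly distributive skew lattice with zero is isomorphic in $\mathsf{SDL}$ to $E^\star$ for some sheaf $E$ (with global support) over some local Priestley space $X$.
   Context: **Skew lattices.** A skew lattice (with zero) is an algebra $(S,\wedge,\vee,0)$ such that $\wedge,\vee$ are associative and idempotent, the absorption identities $x\wedge(x\vee y)=x=x\vee(x\wedge y)$ and $(y\vee x)\wedge x=x=(y\wedge x)\vee x$ hold, and $x\wedge 0=0=0\wedge x$. It is strongly distributive if $x\wedge(y\vee z)=(x\wedge y)\vee(x\wedge z)$ and $(y\vee z)\wedge x=(y\wedge x)\vee(z\wedge x)$ hold, and left-handed if $x\wedge y\wedge x=x\wedge y$ holds (equivalently $x\vee y\vee x=y\vee x$). Homomorphisms preserve $\wedge,\vee,0$. The relation $\mathcal D$ on $S$ is given by $x\mathrel{\mathcal D}y$ iff $x\wedge y\wedge x=x$ and $y\wedge x\wedge y=y$; it is a congruence and $S/\mathcal D$ is the largest lattice quotient of $S$. A homomorphism $h:S\to T$ induces a lattice homomorphism $\overline h:S/\mathcal D\to T/\mathcal D$. A lattice homomorphism $k:L_1\to L_2$ is proper if for every $y\in L_2$ there is $x\in L_1$ with $k(x)\ge y$; a skew lattice homomorphism $h$ is proper if $\overline h$ is proper. $\mathsf{SDL}$ has as objects the left-handed strongly distributive skew lattices with zero and as morphisms the proper homomorphisms. **Local Priestley spaces.** A Priestley space is a compact topological space with a partial order such that whenever $x\not\le y$ there are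 disjoint clopen sets $U,V$ with $U$ an upset, $V$ a downset, $x\in U$, $y\in V$. For a partially ordered topological space $(X,\tau,\le)$, its ordered one-point-compactification is $\widehat X=X\cup\{\ast\}$, $\ast\notin X$, where a set $U$ is open iff $U\in\tau$, or $\ast\in U$ and $X\setminus U$ is closed and compact in $X$; the order extends $\le$ by making $\ast$ the maximum. $(X,\tau,\le)$ is a local Priestley space if its ordered one-point-compactification is a Priestley space. $\mathsf{LPS}$ is the category of local Priestley spaces, a morphism $f:X\to Y$ being the restriction of a continuous monotone map $f:\widehat X\to\widehat Y$ with $f^{-1}(\ast_Y)=\{\ast_X\}$. **Sheaves.** All sheaves (of sets) are assumed to have global support: every stalk is non-empty, equivalently the associated étale map (local homeomorphism) $p:E\to X$ is surjective. An object of $\mathsf{Sh}(\mathsf{LPS})$ is a local Priestley space $X$ together with such a sheaf $E$ on the topological space $X$. A morphism $(X,E)\to(Y,F)$ is a pair $(f,\lambda)$ where $f:X\to Y$ is a morphism of $\mathsf{LPS}$ and $\lambda:F\Rightarrow f_\ast E$ is a natural transformation, with $(f_\ast E)(V)=E(f^{-1}(V))$. The composite of $(f,\lambda):(X,E)\to(Y,F)$ and $(g,\mu):(Y,F)\to(Z,G)$ is $(gf,\sigma)$ with $\sigma_U=\lambda_{g^{-1}(U)}\circ\mu_U$. **The functor $(-)^\star$.** For a sheaf $E$ over a local Priestley space $X$, let $\mathcal L(X)$ be the distributive lattice of compact open downsets of $X$. The dual algebra $E^\star$ has underlying set $\bigsqcup_{U\in\mathcal L(X)}E(U)$; for $a\in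 E(U)$, $b\in E(V)$, $a\wedge b:=a|_{U\cap V}\in E(U\cap V)$, and $a\vee b\in E(U\cup V)$ is the section equal to $b$ on $V$ and to $a$ on $U\setminus V$ (the patch of $a|_{U\setminus V}$ and $b$); $0$ is the unique element of $E(\emptyset)$. For a morphism $(f,\lambda):(X,E)\to(Y,F)$, $(f,\lambda)^\star:F^\star\to E^\star$ sends $a\in F(U)$, $U\in\mathcal L(Y)$, to $\lambda_U(a)\in E(f^{-1}(U))$. *)

(* Defs.v *)
From HB Require Import structures.
From mathcomp Require Import all_boot all_order.
From mathcomp Require Import all_classical.
From mathcomp Require Import topology.

Set Implicit Arguments.
Unset Strict Implicit.
Unset Printing Implicit Defensive.

Import Order.TTheory.

Local Open Scope classical_set_scope.
Local Open Scope quotient_scope.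

Declare Scope skew_scope.
Delimit Scope skew_scope with skew.
Local Open Scope skew_scope.

HB.mixin Record isSkewLattice (S : Type) := {
  smeet : S -> S -> S;
  sjoin : S -> S -> S;
  szero : S;
  smeetA : forall x y z, smeet x (smeet y z) = smeet (smeet x y) z;
  sjoinA : forall x y z, sjoin x (sjoin y z) = sjoin (sjoin x y) z;
  smeetxx : forall x, smeet x x = x;
  sjoinxx : forall x, sjoin x x = x;
  smeetKU : forall x y, smeet x (sjoin x y) = x;
  sjoinKI : forall x y, sjoin x (smeet x y) = x;
  sjoinIK : forall x y, smeet (sjoin y x) x = x;
  smeetUK : forall x y, sjoin (smeet y x) x = x;
  smeetx0 : forall x, smeet x szero = szero;
  smeet0x : forall x, smeet szero x = szero
}.

#[short(type="skewLatticeType")]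
HB.structure Definition SkewLattice := {S of isSkewLattice S}.

Notation "x ⊓ y" := (smeet x y) (at level 40, left associativity) : skew_scope.
Notation "x ⊔ y" := (sjoin x y) (at level 50, left associativity) : skew_scope.

HB.mixin Record SkewLattice_isLeftHandedStronglyDistributive (S : Type)
    of SkewLattice S := {
  smeetUr : forall x y z : S, x ⊓ (y ⊔ z) = (x ⊓ y) ⊔ (x ⊓ z);
  smeetUl : forall x y z : S, (y ⊔ z) ⊓ x = (y ⊓ x) ⊔ (z ⊓ x);
  smeet_left : forall x y : S, x ⊓ y ⊓ x = x ⊓ y
}.

#[short(type="sdlType")]
HB.structure Definition SDL :=
  {S of SkewLattice_isLeftHandedStronglyDistributive S & SkewLattice S}.

(* Facts about a band, that is, an idempotent semigroup; they are used for
   both operations of a skew lattice. *)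
Section Band.
Variables (S : Type) (op : S -> S -> S).
Hypotheses (opA : forall x y z, op x (op y z) = op (op x y) z)
           (opxx : forall x, op x x = x).
Local Notation "x * y" := (op x y).
Let J x y := x * y * x = x.

Lemma band_J a x b : J (a * x * b) x.
Proof.
rewrite /J; set w := a * x * b.
have wb : w * (x * b) = w by rewrite /w -(opA a x b) -(opA a) opxx.
have aw : a * x * w = w by rewrite /w opA opxx.
pose p := x * (b * a * x * w).
have xp : x * p = p by rewrite /p opA opxx.
have wp : w * p = w.
  have -> : w * p = w * (x * b) * (a * x * w) by rewrite /p !opA.
  by rewrite wb aw opxx.
have -> : w * x * w = w * x * (w * x) * p.
  by rewrite -[in RHS](opA (w * x)) -(opA w x p) xp wp.
by rewrite opxx -(opA w x p) xp wp.
Qed.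

Lemma band_J_trans y x z : J x y -> J y z -> J x z.
Proof.
rewrite {1 2}/J => xy yz.
have E : (x * y) * z * (y * x) = x.
  have -> : (x * y) * z * (y * x) = x * (y * z * y) * x by rewrite !opA.
  by rewrite yz xy.
by move: (band_J (x * y) z (y * x)); rewrite E.
Qed.

Lemma band_JC x y : J (x * y) (y * x).
Proof.
have E : x * (y * x) * y = x * y by rewrite -[RHS]opxx !opA.
by move: (band_J x (y * x) y); rewrite E.
Qed.

Lemma band_J_mul w x z : J w x -> J w z -> J w (x * z).
Proof.
rewrite {1 2}/J => wx wz.
have h1 : J w (x * (w * z)).
  have E : w * (x * (w * z)) * w = w.
    have -> : w * (x * (w * z)) * w = (w * x * w) * (z * w) by rewrite !opA.
    by rewrite wx opA wz.
  by move: (band_J w (x * (w * z)) w); rewrite E.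
have h2 : J (w * z * x) (z * x).
  have -> : w * z * x = w * (z * x) * (z * x) by rewrite -[RHS]opA opxx opA.
  exact: band_J.
apply: band_J_trans h1 _; apply: band_J_trans (band_JC _ _) _.
exact: band_J_trans h2 (band_JC _ _).
Qed.

Lemma band_J_mono x x' y y' : J x x' -> J y y' -> J (x * y) (x' * y').
Proof.
move=> xx' yy'; apply: band_J_mul.
  apply: band_J_trans xx'.
  have -> : x * y = x * x * y by rewrite opxx.
  exact: band_J.
apply: band_J_trans yy'.
have -> : x * y = x * y * y by rewrite -opA opxx.
exact: band_J.
Qed.

End Band.

Definition greenD (S : skewLatticeType) (x y : S) :=
  x ⊓ y ⊓ x = x /\ y ⊓ x ⊓ y = y.

Section Green.
Variable S : skewLatticeType.
Implicit Types x y z w : S.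

Let le x y := x ⊓ y ⊓ x = x.
Let geU x y := x ⊔ y ⊔ x = x.

Let geU_le x y : geU y x <-> le x y.
Proof.
split=> [yxy|xyx].
  have yn : y ⊓ (x ⊔ y) = x ⊔ y.
    by rewrite -{1}yxy -sjoinA sjoinIK.
  have E : x ⊓ y ⊓ (x ⊔ y) = x by rewrite -smeetA yn smeetKU.
  by move: (band_J (@smeetA S) (@smeetxx S) x y (x ⊔ y)); rewrite E.
have xm : x ⊔ (y ⊓ x) = y ⊓ x by rewrite -{1}xyx -smeetA smeetUK.
have E : y ⊔ x ⊔ (y ⊓ x) = y by rewrite -sjoinA xm sjoinKI.
by move: (band_J (@sjoinA S) (@sjoinxx S) y x (y ⊓ x)); rewrite E.
Qed.

Lemma greenD_refl x : greenD x x.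
Proof. by split; rewrite !smeetxx. Qed.

Lemma greenD_sym x y : greenD x y -> greenD y x.
Proof. by case. Qed.

Lemma greenD_trans y x z : greenD x y -> greenD y z -> greenD x z.
Proof.
move=> [xy yx] [yz zy]; split.
  exact: (band_J_trans (@smeetA S) (@smeetxx S) xy yz).
exact: (band_J_trans (@smeetA S) (@smeetxx S) zy yx).
Qed.

Lemma greenD_meet x x' y y' :
  greenD x x' -> greenD y y' -> greenD (x ⊓ y) (x' ⊓ y').
Proof.
move=> [xx' x'x] [yy' y'y]; split.
  exact: (band_J_mono (@smeetA S) (@smeetxx S) xx' yy').
exact: (band_J_mono (@smeetA S) (@smeetxx S) x'x y'y).
Qed.

Lemma greenD_join x x' y y' :
  greenD x x' -> greenD y y' -> greenD (x ⊔ y) (x' ⊔ y').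
Proof.
move=> [/geU_le xx' /geU_le x'x] [/geU_le yy' /geU_le y'y].
split; apply/geU_le.
  exact: (band_J_mono (@sjoinA S) (@sjoinxx S) xx' yy').
exact: (band_J_mono (@sjoinA S) (@sjoinxx S) x'x y'y).
Qed.

Lemma greenD_meetC x y : greenD (x ⊓ y) (y ⊓ x).
Proof. by split; exact: (band_JC (@smeetA S) (@smeetxx S)). Qed.

Lemma greenD_joinC x y : greenD (x ⊔ y) (y ⊔ x).
Proof. by split; apply/geU_le; exact: (band_JC (@sjoinA S) (@sjoinxx S)). Qed.

End Green.

Section GreenQuotient.
Variable S : skewLatticeType.

Definition greenDb : rel {classic S} := fun x y => `[< greenD (x : S) (y : S) >].

Lemma greenDb_equiv : equiv_class_of greenDb.
Proof.
split=> [x|x y|y x z].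
- by apply/asboolP; exact: greenD_refl.
- by apply/asboolP/asboolP => /greenD_sym.
- by move=> /asboolP xy /asboolP yz; apply/asboolP; exact: greenD_trans xy yz.
Qed.

Canonical greenDb_equiv_rel := EquivRelPack greenDb_equiv.

Definition quotD : Type := {eq_quot greenDb}.
HB.instance Definition _ := Choice.on quotD.
HB.instance Definition _ := EqQuotient.on quotD.

Definition piD (x : S) : quotD := \pi_quotD (x : {classic S}).
Definition reprD (c : quotD) : S := repr c.

Lemma reprDK c : piD (reprD c) = c.
Proof. exact: reprK. Qed.

Lemma piDP (x y : S) : piD x = piD y <-> greenD x y.
Proof. by split=> [/eqmodP/asboolP|xy]; last by apply/eqmodP/asboolP. Qed.

Definition quotD_meet (c d : quotD) := piD (reprD c ⊓ reprD d).
Definition quotD_join (c d : quotD) := piD (reprD c ⊔ reprD d).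

Lemma quotD_meetE x y : quotD_meet (piD x) (piD y) = piD (x ⊓ y).
Proof. by apply/piDP/greenD_meet; apply/piDP/reprDK. Qed.

Lemma quotD_joinE x y : quotD_join (piD x) (piD y) = piD (x ⊔ y).
Proof. by apply/piDP/greenD_join; apply/piDP/reprDK. Qed.

Let ind (P : quotD -> Prop) : (forall x, P (piD x)) -> forall c, P c.
Proof. by move=> PP c; rewrite -(reprDK c). Qed.

Let meetC : commutative quotD_meet.
Proof.
move=> c d; elim/ind: c => x; elim/ind: d => y.
by rewrite !quotD_meetE; apply/piDP/greenD_meetC.
Qed.

Let joinC : commutative quotD_join.
Proof.
move=> c d; elim/ind: c => x; elim/ind: d => y.
by rewrite !quotD_joinE; apply/piDP/greenD_joinC.
Qed.

Let meetA : associative quotD_meet.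
Proof.
move=> c d e; elim/ind: c => x; elim/ind: d => y; elim/ind: e => z.
by rewrite !quotD_meetE smeetA.
Qed.

Let joinA : associative quotD_join.
Proof.
move=> c d e; elim/ind: c => x; elim/ind: d => y; elim/ind: e => z.
by rewrite !quotD_joinE sjoinA.
Qed.

Let meetxx : idempotent_op quotD_meet.
Proof. move=> c; elim/ind: c => x; by rewrite quotD_meetE smeetxx. Qed.

Let joinKI y x : quotD_meet x (quotD_join x y) = x.
Proof.
elim/ind: x => x; elim/ind: y => y; by rewrite quotD_joinE quotD_meetE smeetKU.
Qed.

Let meetKU y x : quotD_join x (quotD_meet x y) = x.
Proof.
elim/ind: x => x; elim/ind: y => y; by rewrite quotD_meetE quotD_joinE sjoinKI.
Qed.

Definition quotD_le (c d : quotD) := quotD_meet c d == c.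

Let le_refl : reflexive quotD_le.
Proof. by move=> c; rewrite /quotD_le meetxx. Qed.

Let le_anti : antisymmetric quotD_le.
Proof. by move=> c d /andP[/eqP cd /eqP dc]; rewrite -cd meetC dc. Qed.

Let le_trans : transitive quotD_le.
Proof.
by move=> d c e /eqP cd /eqP de; rewrite /quotD_le -{1}cd -meetA de cd.
Qed.

Fact quotD_display : Order.disp_t. Proof. exact: Order.Disp tt tt. Qed.

HB.instance Definition _ :=
  Order.Le_isPOrder.Build quotD_display quotD le_refl le_anti le_trans.

HB.instance Definition _ := Order.POrder_isLattice.Build quotD_display quotD
  meetC joinC meetA joinA joinKI meetKU (fun _ _ => erefl).

Lemma meet_piD x y : (piD x `&` piD y)%O = piD (x ⊓ y).
Proof. exact: quotD_meetE. Qed.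

Lemma join_piD x y : (piD x `|` piD y)%O = piD (x ⊔ y).
Proof. exact: quotD_joinE. Qed.

End GreenQuotient.

Record skewHom (S T : skewLatticeType) := SkewHom {
  skew_hom :> S -> T;
  skew_homI : forall x y, skew_hom (x ⊓ y) = skew_hom x ⊓ skew_hom y;
  skew_homU : forall x y, skew_hom (x ⊔ y) = skew_hom x ⊔ skew_hom y;
  skew_hom0 : skew_hom szero = szero
}.

(* Independent of the chosen representatives: see [induced_piD]. *)
Definition induced (S T : skewLatticeType) (h : skewHom S T) :
  quotD S -> quotD T := fun c => piD (h (reprD c)).

Section Induced.
Variables (S T : skewLatticeType) (h : skewHom S T).

Lemma induced_piD x : induced h (piD x) = piD (h x).
Proof.
have /piDP[e1 e2] := reprDK (piD x).
by apply/piDP; split; rewrite -!skew_homI ?e1 ?e2.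
Qed.

Lemma induced_meet : {morph induced h : c d / (c `&` d)%O}.
Proof.
move=> c d; rewrite -(reprDK c) -(reprDK d) meet_piD !induced_piD meet_piD.
by rewrite skew_homI.
Qed.

Lemma induced_join : {morph induced h : c d / (c `|` d)%O}.
Proof.
move=> c d; rewrite -(reprDK c) -(reprDK d) join_piD !induced_piD join_piD.
by rewrite skew_homU.
Qed.

End Induced.

Definition proper_map d1 d2 (L1 : latticeType d1) (L2 : latticeType d2)
    (k : L1 -> L2) :=
  forall y, exists x, (y <= k x)%O.

Record sdlHom (S T : sdlType) := SdlHom {
  sdl_hom :> skewHom S T;
  sdl_hom_proper : proper_map (induced sdl_hom)
}.

Definition sdl_isomorphic (S T : sdlType) :=
  exists (f : sdlHom S T) (g : sdlHom T S), cancel f g /\ cancel g f.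

Definition is_upset d (P : porderType d) (A : set P) :=
  forall x y, (x <= y)%O -> A x -> A y.

Definition is_downset d (P : porderType d) (A : set P) :=
  forall x y, (x <= y)%O -> A y -> A x.

Definition priestley_space d (X : POrderedTopological.type d) :=
  compact [set: X] /\
  forall x y : X, ~~ (x <= y)%O ->
    exists U V : set X,
      [/\ clopen U, clopen V, U `&` V = set0 &
          [/\ is_upset U, is_downset V, U x & V y]].

Section OnePointOrder.
Variables (d : Order.disp_t) (X : POrderedTopological.type d).
Local Notation opc := (one_point_compactification X).

Definition opc_le (x y : opc) : bool :=
  match x, y with
  | _, None => true
  | None, Some _ => false
  | Some a, Some b => (a <= b)%O
  end.

Let opc_le_refl : reflexive opc_le.
Proof. by case=> [x|] //=. Qed.

Let opc_le_anti : antisymmetric opc_le.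
Proof. by case=> [x|] [y|] //= /le_anti ->. Qed.

Let opc_le_trans : transitive opc_le.
Proof. by case=> [x|] [y|] [z|] //=; exact: le_trans. Qed.

HB.instance Definition _ :=
  Order.Le_isPOrder.Build d opc opc_le_refl opc_le_anti opc_le_trans.

End OnePointOrder.

(* The topology comes from [one_point_compactification]: a neighborhood of
   [None] contains [None] and the complement of a closed compact set. *)
Record lpsType := LpsType {
  lps_display : Order.disp_t;
  lps_space :> POrderedTopological.type lps_display;
  lps_priestley : priestley_space (one_point_compactification lps_space)
}.

Lemma lps_hausdorff (X : lpsType) : hausdorff_space X.
Proof.
have [_ sep] := lps_priestley X.
rewrite open_hausdorff => x y xy.
have : ~~ (x <= y)%O || ~~ (y <= x)%O.
  by rewrite -negb_and -eq_le.
pose s (A : set (one_point_compactification X)) : set X := [set z | A (Some z)].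
have os A : open A -> open (s A).
  move=> oA; apply: open_comp oA => z _.
  exact: one_point_compactification_some_continuous.
case/orP=> [xy'|yx'].
  have [U [V [[oU _] [oV _] UV [_ _ Ux Vy]]]] := sep (Some x) (Some y) xy'.
  exists (s U, s V); first by split; apply/mem_set.
  split=> /=; [exact: os|exact: os|].
  apply/eqP; rewrite -subset0 => z [Uz Vz].
  by have : set0 (Some z); first by rewrite -UV.
have [U [V [[oU _] [oV _] UV [_ _ Uy Vx]]]] := sep (Some y) (Some x) yx'.
exists (s V, s U); first by split; apply/mem_set.
split=> /=; [exact: os|exact: os|].
apply/eqP; rewrite -subset0 => z [Vz Uz].
by have : set0 (Some z); first by rewrite -UV.
Qed.

Record opens (X : topologicalType) := Opens {
  opens_set :> set X;
  opens_open : open opens_set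
}.

Lemma opens_eq (X : topologicalType) (U V : opens X) :
  U = V :> set X -> U = V.
Proof.
case: U V => [U oU] [V oV] /= UV; rewrite UV in oU *.
by congr Opens; exact: Prop_irrelevance.
Qed.

Definition opensI (X : topologicalType) (U V : opens X) : opens X :=
  Opens (openI (opens_open U) (opens_open V)).

Lemma opensIl (X : topologicalType) (U V : opens X) : opensI U V `<=` U.
Proof. exact: subIsetl. Qed.

Lemma opensIr (X : topologicalType) (U V : opens X) : opensI U V `<=` V.
Proof. exact: subIsetr. Qed.

Record presheaf (X : topologicalType) := Presheaf {
  sections :> opens X -> Type;
  restr : forall U V : opens X, V `<=` U -> sections U -> sections V;
  restr_id : forall (U : opens X) (UU : U `<=` U) s, restr UU s = s;
  restr_comp : forall (U V W : opens X) (VU : V `<=` U) (WV : W `<=` V)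
    (WU : W `<=` U) s, restr WV (restr VU s) = restr WU s
}.

Definition sheaf_axiom (X : topologicalType) (F : presheaf X) :=
  forall (I : Type) (U : opens X) (W : I -> opens X)
    (WU : forall i, W i `<=` U) (s : forall i, F (W i)),
    U `<=` \bigcup_i W i ->
    (forall i j,
      restr (@opensIl _ (W i) (W j)) (s i) = restr (@opensIr _ (W i) (W j)) (s j)) ->
    exists! t : F U, forall i, restr (WU i) t = s i.

Section Stalk.
Variables (X : topologicalType) (F : presheaf X) (x : X).

Record pregerm := Pregerm {
  pregerm_open : opens X;
  pregerm_mem : opens_set pregerm_open x;
  pregerm_section : F pregerm_open
}.

Definition germ_rel : rel {classic pregerm} := fun a b =>
  `[< exists (W : opens X) (Wa : W `<=` pregerm_open (a : pregerm))
        (Wb : W `<=` pregerm_open (b : pregerm)),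
        opens_set W x /\ restr Wa (pregerm_section a) = restr Wb (pregerm_section b) >].

Lemma germ_rel_equiv : equiv_class_of germ_rel.
Proof.
split=> [a|a b|b a c].
- apply/asboolP; exists (pregerm_open (a : pregerm)), (fun _ => id), (fun _ => id).
  by split=> //; exact: pregerm_mem.
- by apply/asboolP/asboolP => -[W [h1 [h2 [Wx e]]]]; exists W, h2, h1.
- move=> /asboolP[W [Wa [Wb [Wx e]]]] /asboolP[W' [Wb' [Wc [Wx' e']]]].
  apply/asboolP; exists (opensI W W').
  exists (subset_trans (@opensIl _ W W') Wa).
  exists (subset_trans (@opensIr _ W W') Wc); split; first by [].
  rewrite -(restr_comp Wa (@opensIl _ W W')) e.
  rewrite -(restr_comp Wc (@opensIr _ W W')) -e'.
  by rewrite !(restr_comp _ _ (subset_trans (@opensIl _ W W') Wb)).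
Qed.

Canonical germ_equiv_rel := EquivRelPack germ_rel_equiv.

Definition stalk : Type := {eq_quot germ_rel}.

Definition germ (U : opens X) (Ux : opens_set U x) (s : F U) : stalk :=
  \pi_{eq_quot germ_rel} (Pregerm Ux s : {classic pregerm}).

Lemma germP (U V : opens X) (Ux : opens_set U x) (Vx : opens_set V x) (s : F U) (t : F V) :
  germ Ux s = germ Vx t <->
  exists (W : opens X) (WU : W `<=` U) (WV : W `<=` V),
    opens_set W x /\ restr WU s = restr WV t.
Proof. by split=> [/eqmodP/asboolP|h]; last by apply/eqmodP/asboolP. Qed.

End Stalk.

Record gsheaf (X : topologicalType) := Gsheaf {
  gsheaf_presheaf :> presheaf X;
  gsheafP : sheaf_axiom gsheaf_presheaf;
  gsheaf_global_support : forall x, inhabited (stalk gsheaf_presheaf x)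
}.

Section CompactOpenDownsets.
Variable X : lpsType.

(* The elements of the lattice L(X). *)
Record codownset := Codownset {
  codownset_opens :> opens X;
  codownset_compact : compact codownset_opens;
  codownset_downset : is_downset codownset_opens
}.

Lemma codownset_eq (U V : codownset) : U = V :> set X -> U = V.
Proof.
case: U V => [U cU dU] [V cV dV] /= /opens_eq UV; rewrite UV in cU dU *.
by congr Codownset; exact: Prop_irrelevance.
Qed.

Lemma codownset_closed (U : codownset) : closed U.
Proof. exact: compact_closed (@lps_hausdorff X) (@codownset_compact U). Qed.

Lemma codownsetI_compact (U V : codownset) : compact (opensI U V).
Proof.
apply: compact_closedI; first exact: codownset_compact.
exact: codownset_closed.
Qed.

Lemma codownsetI_downset (U V : codownset) : is_downset (opensI U V).
Proof.
by move=> x y xy [Uy Vy]; split;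
  [exact: codownset_downset xy Uy | exact: codownset_downset xy Vy].
Qed.

Definition codownsetI (U V : codownset) : codownset :=
  Codownset (codownsetI_compact (U:=U) (V:=V)) (@codownsetI_downset U V).

Definition opensU (U V : opens X) : opens X :=
  Opens (openU (opens_open U) (opens_open V)).

Lemma codownsetU_compact (U V : codownset) : compact (opensU U V).
Proof. by apply: compactU; exact: codownset_compact. Qed.

Lemma codownsetU_downset (U V : codownset) : is_downset (opensU U V).
Proof.
by move=> x y xy [Uy|Vy];
  [left; exact: codownset_downset xy Uy | right; exact: codownset_downset xy Vy].
Qed.

Definition codownsetU (U V : codownset) : codownset :=
  Codownset (codownsetU_compact (U:=U) (V:=V)) (@codownsetU_downset U V).

Lemma codownset0_downset : is_downset (Opens open0 : opens X).
Proof. by []. Qed.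

Definition codownset0 : codownset :=
  @Codownset (Opens open0) compact0 codownset0_downset.

Lemma opensD_open (U V : codownset) : open (U `\` V).
Proof.
rewrite setDE; apply: openI; first exact: opens_open.
exact/closed_openC/codownset_closed.
Qed.

Definition opensD (U V : codownset) : opens X :=
  Opens (@opensD_open U V).

End CompactOpenDownsets.

Section Dual.
Variables (X : lpsType) (E : gsheaf X).

Definition dual : Type := {U : codownset X & E U}.

Definition dual_meet (a b : dual) : dual :=
  existT _ (codownsetI (tag a) (tag b))
    (restr (@opensIl _ (tag a) (tag b)) (tagged a)).

Section Patch.
Variables (U V : codownset X) (a : E U) (b : E V).

Lemma patch_subr : V `<=` codownsetU U V. Proof. exact: subsetUr. Qed.
Lemma patch_subl : opensD U V `<=` codownsetU U V.
Proof. by move=> x [Ux _]; left. Qed.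
Lemma patch_subD : opensD U V `<=` U. Proof. by move=> x []. Qed.

Lemma patch_ex : exists! s : E (codownsetU U V),
  restr patch_subr s = b /\ restr patch_subl s = restr patch_subD a.
Proof.
pose W (i : bool) : opens X :=
  if i then codownset_opens V else opensD U V.
have WU i : W i `<=` codownsetU U V.
  by case: i; [exact: patch_subr|exact: patch_subl].
pose s (i : bool) : E (W i) :=
  if i as i return E (W i) then b else restr patch_subD a.
have E0 (O : opens X) (s1 s2 : E O) : O `<=` set0 -> s1 = s2.
  move=> O0.
  have [t [_ tu]] := @gsheafP _ E False O (False_rect _)
    (fun i => False_ind _ i) (fun i => False_rect _ i)
    (fun x Ox => False_ind _ (O0 x Ox)) (fun i => False_ind _ i).
  by rewrite -(tu s1) // -(tu s2).
have cov : codownsetU U V `<=` \bigcup_i W i.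
  move=> x UVx; have [Vx|Vx] := pselect (opens_set V x); first by exists true.
  by exists false => //=; split=> //; case: UVx.
have comp i j : restr (@opensIl _ (W i) (W j)) (s i) =
                restr (@opensIr _ (W i) (W j)) (s j).
  case: i; case: j => /=.
  - by congr restr; exact: Prop_irrelevance.
  - by apply: E0 => x [Vx []].
  - by apply: E0 => x [[_ Vx]].
  - by congr restr; exact: Prop_irrelevance.
have [t [tP tu]] := gsheafP WU cov comp.
exists t; split.
  split; first by rewrite -[RHS](tP true); congr restr; exact: Prop_irrelevance.
  by rewrite -[RHS](tP false); congr restr; exact: Prop_irrelevance.
move=> t' [t'r t'l]; apply: tu => -[] /=.
  by rewrite -[RHS]t'r; congr restr; exact: Prop_irrelevance.
by rewrite -[RHS]t'l; congr restr; exact: Prop_irrelevance.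
Qed.

(* The section equal to b on V and to a on U minus V. *)
Definition patch : E (codownsetU U V) := sval (cid patch_ex).

Lemma patchr : restr patch_subr patch = b.
Proof. by rewrite /patch; case: cid => s [[]]. Qed.

Lemma patchl : restr patch_subl patch = restr patch_subD a.
Proof. by rewrite /patch; case: cid => s [[]]. Qed.

End Patch.

Definition dual_join (a b : dual) : dual :=
  existT _ (codownsetU (tag a) (tag b)) (patch (tagged a) (tagged b)).

Lemma section0_ex : exists! s : E (codownset0 X), True.
Proof.
have [t [_ tu]] := @gsheafP _ E False (codownset0 X) (False_rect _)
  (fun i => False_ind _ i) (fun i => False_rect _ i)
  (fun x Ox => False_ind _ Ox) (fun i => False_ind _ i).
by exists t; split=> // s _; exact: tu.
Qed.

Definition dual0 : dual := existT _ (codownset0 X) (sval (cid section0_ex)).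

(* The partial section of the stalks given by an element of the dual; the
   identities of a skew lattice are checked pointwise on it. *)
Definition dual_germ (p : dual) (x : X) : option (stalk E x) :=
  if pselect (opens_set (tag p) x) is left h then Some (germ h (tagged p))
  else None.

Lemma dual_germ_in (p : dual) x (px : opens_set (tag p) x) :
  dual_germ p x = Some (germ px (tagged p)).
Proof.
rewrite /dual_germ; case: pselect => // h.
by congr (Some (germ _ _)); exact: Prop_irrelevance.
Qed.

Lemma dual_germ_out (p : dual) x : ~ opens_set (tag p) x -> dual_germ p x = None.
Proof. by rewrite /dual_germ; case: pselect. Qed.

Lemma dual_germ_inj p q : (forall x, dual_germ p x = dual_germ q x) -> p = q.
Proof.
case: p q => [U a] [V b] pq.
have UV : U = V.
  apply/codownset_eq/seteqP; split=> x h; apply: contrapT => h'.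
    have := pq x; rewrite (@dual_germ_in (existT _ U a) x h).
    by rewrite (@dual_germ_out (existT _ V b)).
  have := pq x; rewrite (@dual_germ_in (existT _ V b) x h).
  by rewrite (@dual_germ_out (existT _ U a)).
case: V / UV b pq => b pq; congr existT.
have loc (x : {x | opens_set U x}) : exists (W : opens X) (WU : W `<=` U),
    opens_set W (sval x) /\ restr WU a = restr WU b.
  case: x => x Ux /=.
  have := pq x; rewrite (@dual_germ_in (existT _ U a) x Ux).
  rewrite (@dual_germ_in (existT _ U b) x Ux) /= => -[].
  move=> /germP[W [WU [WU' [Wx e]]]]; exists W, WU; split=> //.
  by rewrite e; congr restr; exact: Prop_irrelevance.
pose W x := sval (cid (loc x)).
have WP x : exists (WU : W x `<=` U),
  opens_set (W x) (sval x) /\ restr WU a = restr WU b := svalP (cid (loc x)).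
have WU x : W x `<=` U by have [] := WP x.
have cov : U `<=` \bigcup_x W x.
  by move=> x Ux; exists (exist _ x Ux) => //; have [? []] := WP (exist _ x Ux).
have e x : restr (WU x) a = restr (WU x) b.
  by have [WU' [_]] := WP x; rewrite (Prop_irrelevance (WU x) WU').
have [|t [_ tu]] := gsheafP (s := fun x => restr (WU x) a) WU cov.
  move=> i j; rewrite (restr_comp _ _ (subset_trans (@opensIl _ (W i) (W j)) (WU i))).
  by rewrite (restr_comp _ _ (subset_trans (@opensIl _ (W i) (W j)) (WU i))).
by rewrite -(tu a) // -(tu b).
Qed.

Lemma dual_germ_meet p q x : dual_germ (dual_meet p q) x =
  if dual_germ q x is Some _ then dual_germ p x else None.
Proof.
have [qx|qx] := pselect (opens_set (tag q) x); last first.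
  by rewrite (dual_germ_out qx) dual_germ_out // => -[].
rewrite (dual_germ_in qx).
have [px|px] := pselect (opens_set (tag p) x); last first.
  by rewrite (dual_germ_out px) dual_germ_out // => -[].
rewrite (dual_germ_in px) (@dual_germ_in (dual_meet p q) x (conj px qx)).
congr Some; apply/germP; exists (opensI (tag p) (tag q)), (fun _ => id).
by exists (@opensIl _ _ _); split=> //; rewrite restr_id.
Qed.

Lemma dual_germ_join p q x : dual_germ (dual_join p q) x =
  if dual_germ q x is Some s then Some s else dual_germ p x.
Proof.
have [qx|qx] := pselect (opens_set (tag q) x).
  rewrite (dual_germ_in qx) (@dual_germ_in (dual_join p q) x (or_intror qx)).
  congr Some; apply/germP; exists (tag q), (@patch_subr _ _), (fun _ => id).
  by split=> //; rewrite restr_id patchr.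
rewrite (dual_germ_out qx).
have [px|px] := pselect (opens_set (tag p) x); last first.
  by rewrite (dual_germ_out px) dual_germ_out // => -[].
rewrite (dual_germ_in px) (@dual_germ_in (dual_join p q) x (or_introl px)).
congr Some; apply/germP; exists (opensD (tag p) (tag q)).
exists (@patch_subl _ _), (@patch_subD _ _).
by split=> //; rewrite patchl.
Qed.

Lemma dual_germ0 x : dual_germ dual0 x = None.
Proof. exact: dual_germ_out. Qed.

Local Ltac pointwise :=
  intros; apply: dual_germ_inj => ?;
  rewrite ?(dual_germ_meet, dual_germ_join, dual_germ0) //;
  do ?case: dual_germ => [?|] //.

Let dual_smeetA : forall p q r, dual_meet p (dual_meet q r) = dual_meet (dual_meet p q) r.
Proof. pointwise. Qed.

Let dual_sjoinA : forall p q r, dual_join p (dual_join q r) = dual_join (dual_join p q) r.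
Proof. pointwise. Qed.

Let dual_smeetxx : forall p, dual_meet p p = p.
Proof. pointwise. Qed.

Let dual_sjoinxx : forall p, dual_join p p = p.
Proof. pointwise. Qed.

Let dual_smeetKU : forall p q, dual_meet p (dual_join p q) = p.
Proof. pointwise. Qed.

Let dual_sjoinKI : forall p q, dual_join p (dual_meet p q) = p.
Proof. pointwise. Qed.

Let dual_sjoinIK : forall p q, dual_meet (dual_join q p) p = p.
Proof. pointwise. Qed.

Let dual_smeetUK : forall p q, dual_join (dual_meet q p) p = p.
Proof. pointwise. Qed.

Let dual_smeetx0 : forall p, dual_meet p dual0 = dual0.
Proof. pointwise. Qed.

Let dual_smeet0x : forall p, dual_meet dual0 p = dual0.
Proof. pointwise. Qed.

Let dual_smeetUr : forall p q r,
  dual_meet p (dual_join q r) = dual_join (dual_meet p q) (dual_meet p r).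
Proof. pointwise. Qed.

Let dual_smeetUl : forall p q r,
  dual_meet (dual_join q r) p = dual_join (dual_meet q p) (dual_meet r p).
Proof. pointwise. Qed.

Let dual_smeet_left : forall p q, dual_meet (dual_meet p q) p = dual_meet p q.
Proof. pointwise. Qed.

HB.instance Definition _ := isSkewLattice.Build dual
  dual_smeetA dual_sjoinA
  dual_smeetxx dual_sjoinxx dual_smeetKU dual_sjoinKI
  dual_sjoinIK dual_smeetUK dual_smeetx0 dual_smeet0x.

HB.instance Definition _ := SkewLattice_isLeftHandedStronglyDistributive.Build dual
  dual_smeetUr dual_smeetUl dual_smeet_left.

End Dual.

(* Main.v *)
From HB Require Import structures.
From mathcomp Require Import all_boot all_order all_classical topology.
Require Import Defs.

(** Let S be a left-handed strongly distributive skew lattice with zero. Its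
    spectrum consists of the nonzero homomorphisms x from S to the two-element
    lattice (the prime filters of the lattice quotient of S), topologized by
    the boxes {x | x w = 1, x c = 0} and ordered by reverse inclusion of the
    filters, so that the cones {x | x a = 1} are compact open downsets; these
    cones also provide the separation that makes the ordered
    one-point compactification a Priestley space.

    An element a of S is thought of as a section over its cone. Two elements a
    and b defined at x agree there when they agree on some box around x, that
    is, when
    (a ⊓ w) ⊔ c = (b ⊓ w) ⊔ c for some w and c with x w = 1 and x c = 0:
    meeting with w restricts a section to the cone of w, and joining with c
    overwrites it by c on the cone of c. The value of a at x is the set
    [class a x] of the elements that agree with a at x. A section of the sheaf
    is a function sending points to sets of elements, empty outside its domain
    and locally of the form [class a]. The map [represent] sends a to
    [class a] over the cone of a, and it is a homomorphism into the dual
    algebra by pointwise computation. Both halves of bijectivity rest on one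
    argument.

    Given an ideal I and a filter disjoint from it, Zorn's lemma extends the
    filter to a maximal one F disjoint from I. It is prime, hence a point, and
    every c outside F has a witness f in F with f ⊓ c in I ([point_maximal]).
    If some property holds on a box {w, not c} around the point F, and holds on
    every cone given by an element of I, then it holds on the cone of f ⊓ w,
    because this cone is covered by the box and by the cone of f ⊓ c.

    - Injectivity ([class_inj]): take for I the elements w such that
      a ⊓ w = b ⊓ w. If a and b have the same classes but a is not in I, a
      point containing a and maximal for I yields, by the above and by
      cancellation ([join_meet_cancel]), an element of F in I.
    - Surjectivity ([represent_surj]): for a section s on a compact open
      downset U, take for I the elements lying below some element that
      represents s on its own cone. If a point x of U had no such element,
      a maximal filter containing x would be a point below x, hence in U, and
      the same argument would produce an element of I in it
      ([represents_point]). So U is covered by cones on which s is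
      represented; these are directed under joins, so by compactness one of
      them is U. *)

Set Implicit Arguments.
Unset Strict Implicit.
Unset Printing Implicit Defensive.

Local Open Scope classical_set_scope.
Local Open Scope skew_scope.

(** * The natural preorder and cancellation *)

(** The preorder whose associated equivalence is Green's relation D; in the
    left-handed case one equation suffices to express it. *)
Definition below (S : sdlType) (x y : S) := x ⊓ y = x.
Notation "x ⊑ y" := (below x y) (at level 70, no associativity) : skew_scope.

Section Algebra.
Variable S : sdlType.
Implicit Types a b c p q u v w x y z : S.

Lemma join_meetK x y : (x ⊓ y) ⊔ x = x.
Proof. by rewrite -(smeet_left x y) smeetUK. Qed.

Lemma below_join x y : x ⊑ y -> x ⊔ y = y.
Proof. by move=> xy; rewrite -{1}xy smeetUK. Qed.

(** The restriction of x to y depends only on the D-class of y: u = x ⊓ y and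
    v = x ⊓ z are D-related, and x absorbs u, so distributing the meet with v
    over x = x ⊔ u gives v = v ⊔ u = u. *)
Lemma meet_greenD x y z : y ⊑ z -> z ⊑ y -> x ⊓ y = x ⊓ z.
Proof.
move=> yz zy; set u := x ⊓ y; set v := x ⊓ z.
have uv : u ⊓ v = u by rewrite /u /v smeetA smeet_left -smeetA yz.
have vu : v ⊑ u by rewrite /below /u /v smeetA smeet_left -smeetA zy.
have xv : x ⊓ v = v by rewrite /v smeetA smeetxx.
by rewrite -xv -[X in X ⊓ v](sjoinKI x y) smeetUl xv -/u uv below_join.
Qed.

Lemma below_refl x : x ⊑ x. Proof. exact: smeetxx. Qed.

Lemma below_trans y x z : x ⊑ y -> y ⊑ z -> x ⊑ z.
Proof. by move=> xy yz; rewrite /below -xy -smeetA yz. Qed.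

Lemma below_meetl x y : x ⊓ y ⊑ x. Proof. exact: smeet_left. Qed.

Lemma below_meetr x y : x ⊓ y ⊑ y.
Proof. by rewrite /below -smeetA smeetxx. Qed.

Lemma below_meet x y z : x ⊑ y -> x ⊑ z -> x ⊑ y ⊓ z.
Proof. by move=> xy xz; rewrite /below smeetA xy xz. Qed.

Lemma below_meet2 x y x' y' : x ⊑ x' -> y ⊑ y' -> x ⊓ y ⊑ x' ⊓ y'.
Proof.
move=> xx yy; apply: below_meet.
  exact: below_trans (below_meetl _ _) xx.
exact: below_trans (below_meetr _ _) yy.
Qed.

Lemma below_joinl x y : x ⊑ x ⊔ y. Proof. exact: smeetKU. Qed.

Lemma below_joinr x y : y ⊑ x ⊔ y.
Proof.
by rewrite /below -[X in X ⊓ _](sjoinIK y x) smeet_left sjoinIK.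
Qed.

(** Left normality: strong distributivity makes the order of the restrictions
    applied to an element irrelevant. *)
Lemma meetAC x y z : x ⊓ y ⊓ z = x ⊓ z ⊓ y.
Proof.
rewrite -!smeetA; apply: meet_greenD.
  by apply: below_meet; [apply: below_meetr|apply: below_meetl].
by apply: below_meet; [apply: below_meetr|apply: below_meetl].
Qed.

(** A section p is recovered from its part on c and its part off c: it is
    (p ⊔ c) restricted to the domain of p, overwritten by p ⊓ c. *)
Lemma join_meet_cancel p q c : p ⊑ q -> q ⊑ p ->
  p ⊓ c = q ⊓ c -> p ⊔ c = q ⊔ c -> p = q.
Proof.
move=> pq qp mc jc.
have E r : (r ⊔ c) ⊓ r ⊔ (r ⊓ c) = r.
  rewrite smeetUl smeetxx -sjoinA (below_join (x := c ⊓ r)) ?sjoinKI //.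
  by apply: below_meet; [apply: below_meetr|apply: below_meetl].
by rewrite -(E p) -(E q) mc jc (meet_greenD _ pq qp).
Qed.

(** * Maximal filters disjoint from an ideal *)

Record sfilter (F : set S) : Prop := {
  sfilter_ex : F !=set0;
  sfilter_up : forall x y, x ⊑ y -> F x -> F y;
  sfilter_meet : forall x y, F x -> F y -> F (x ⊓ y)
}.

(** Since [below] identifies D-related elements, these are the filters and
    ideals of the lattice quotient of S, described upstairs. *)
Record sideal (I : set S) : Prop := {
  sideal_down : forall x y, x ⊑ y -> I y -> I x;
  sideal_join : forall x y, I x -> I y -> I (x ⊔ y)
}.

Lemma maximal_sfilter (F0 I : set S) : sfilter F0 -> sideal I ->
  F0 `&` I = set0 ->
  exists F, [/\ sfilter F, F0 `<=` F, F `&` I = set0 &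
    forall c, ~ F c -> exists2 f, F f & I (f ⊓ c)].
Proof.
move=> F0f Ii F0I.
(* Taking the union with F0 makes the empty chain harmless: its union is the
   empty set, which stands for F0 itself. *)
pose P (A : set S) := sfilter (F0 `|` A) /\ (F0 `|` A) `&` I = set0.
have [G GP tG|A [[Af AI] Amax]] := @Zorn_bigcup S P.
  have GE a b : (F0 `|` \bigcup_(X in G) X) a -> (F0 `|` \bigcup_(X in G) X) b ->
      (F0 a /\ F0 b) \/ exists2 X, G X & (F0 `|` X) a /\ (F0 `|` X) b.
    move=> [Fa|[X GX Xa]] [Fb|[Y GY Yb]]; first by left.
    - by right; exists Y => //; split; [left|right].
    - by right; exists X => //; split; [right|left].
    - by right; have [XY|YX] := tG X Y GX GY; [exists Y|exists X] => //;
        split; right; do ?exact: XY; do ?exact: YX.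
  split; first split.
  - by have [x Fx] := sfilter_ex F0f; exists x; left.
  - move=> x y xy Fx; have [[Fx' _]|[X GX [Xx _]]] := GE x x Fx Fx.
      by left; apply: sfilter_up xy Fx'.
    have [Xf _] := GP X GX; have [|] := sfilter_up Xf xy Xx; first by left.
    by right; exists X.
  - move=> x y Fx Fy; have [[Fx' Fy']|[X GX [Xx Xy]]] := GE x y Fx Fy.
      by left; apply: sfilter_meet.
    have [Xf _] := GP X GX; have [|] := sfilter_meet Xf Xx Xy; first by left.
    by right; exists X.
  - rewrite -subset0 => x [Fx Ix]; have [[Fx' _]|[X GX [Xx _]]] := GE x x Fx Fx.
      by rewrite -F0I.
    by have [_ <-] := GP X GX.
exists (F0 `|` A); split=> //.
move=> c Fc; apply: contrapT => nex.
(* The filter generated by F0 `|` A and c; if it missed I, it would contradict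
   the maximality of A. *)
pose B : set S := [set y | exists2 f, (F0 `|` A) f & f ⊓ c ⊑ y].
have AB : F0 `|` A `<=` B by move=> f Ff; exists f => //; apply: below_meetl.
have F0B : F0 `|` B = B.
  by apply/seteqP; split=> [y [F0y|//]|y By]; [apply: AB; left|right].
have Bc : B c.
  have [f Ff] := sfilter_ex Af.
  by exists f => //; apply: below_meetr.
apply: (Amax B); first split.
- by move=> y Ay; apply: AB; right.
- by move=> BA; apply: Fc; right; apply: BA.
rewrite /P F0B; split; first split.
- by exists c.
- by move=> x y xy [f Ff fx]; exists f => //; apply: below_trans xy.
- move=> x y [f Ff fx] [g Fg gy]; exists (f ⊓ g); first exact: sfilter_meet.
  apply: below_meet.
    by apply: below_trans fx; apply: below_meet2 (below_meetl _ _) (below_refl _).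
  by apply: below_trans gy; apply: below_meet2 (below_meetr _ _) (below_refl _).
- rewrite -subset0 => y [[f Ff fy] Iy]; apply: nex; exists f => //.
  exact: sideal_down fy Iy.
Qed.

(** If f ⊓ x and g ⊓ y are in I for some f and g in F, then so is
    f ⊓ g ⊓ (x ⊔ y), by distributivity. *)
Lemma maximal_sfilter_prime (F I : set S) : sfilter F -> sideal I ->
  F `&` I = set0 -> (forall c, ~ F c -> exists2 f, F f & I (f ⊓ c)) ->
  forall x y, F (x ⊔ y) -> F x \/ F y.
Proof.
move=> Ff Ii FI Fmax x y Fxy; apply: contrapT => /not_orP[nFx nFy].
have [f Ff' fx] := Fmax x nFx; have [g Fg gy] := Fmax y nFy.
have : (F `&` I) (f ⊓ g ⊓ (x ⊔ y)); last by rewrite FI.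
split; first by do ?apply: sfilter_meet.
rewrite smeetUr; apply: sideal_join => //.
  by apply: (sideal_down Ii) fx; apply: below_meet2 (below_meetl _ _) (below_refl _).
by apply: (sideal_down Ii) gy; apply: below_meet2 (below_meetr _ _) (below_refl _).
Qed.

End Algebra.

(** * Points and germs *)

(** The points of the spectrum: prime filters of S, given by their
    characteristic functions. *)
Record point (S : sdlType) := Point {
  pt :> S -> bool;
  ptI : forall a b, pt (a ⊓ b) = pt a && pt b;
  ptU : forall a b, pt (a ⊔ b) = pt a || pt b;
  pt0 : pt szero = false;
  pt_ex : exists a, pt a
}.

Section Points.
Variable S : sdlType.
Implicit Types (a b c w : S) (x y : point S).

Lemma pt_inj x y : pt x =1 pt y -> x = y.
Proof.
case: x y => [x h1 h2 h3 h4] [y k1 k2 k3 k4] /= /funext e; subst y.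
by congr Point; exact: Prop_irrelevance.
Qed.

Lemma pt_below x a b : a ⊑ b -> x a -> x b.
Proof. by move=> <-; rewrite ptI => /andP[]. Qed.

Lemma pt_sfilter x : sfilter [set a | x a].
Proof.
split; first exact: pt_ex.
- exact: pt_below.
- by move=> a b /= xa xb; rewrite ptI xa.
Qed.

(** The source of all points. The last clause is what both injectivity and
    surjectivity exploit: anything known on the box of w and c around x is
    turned, with the help of f ⊓ c, into knowledge on the cone of f ⊓ w. *)
Lemma point_maximal (F I : set S) : sfilter F -> sideal I -> I szero ->
  F `&` I = set0 ->
  exists x : point S, [/\ F `<=` [set a | x a],
    I `<=` [set a | ~~ x a] &
    forall c, ~~ x c -> exists2 f, x f & I (f ⊓ c)].
Proof.
move=> Ff Ii I0 FI.
have [G [Gf FG GI Gmax]] := maximal_sfilter Ff Ii FI.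
have GIn a : G a -> I a -> False by move=> Ga Ia; rewrite -[False]/(set0 a) -GI.
have Gp := maximal_sfilter_prime Gf Ii GI Gmax.
have gI a b : `[< G (a ⊓ b) >] = `[< G a >] && `[< G b >].
  apply/asboolP/andP => [Gab|[/asboolP Ga /asboolP Gb]].
    by split; apply/asboolP; apply: sfilter_up Gab => //;
      [apply: below_meetl|apply: below_meetr].
  exact: sfilter_meet.
have gU a b : `[< G (a ⊔ b) >] = `[< G a >] || `[< G b >].
  apply/asboolP/orP => [/Gp[] Ga|[] /asboolP Ga].
  - by left; apply/asboolP.
  - by right; apply/asboolP.
  - by apply: sfilter_up Ga => //; apply: below_joinl.
  - by apply: sfilter_up Ga => //; apply: below_joinr.
have g0 : `[< G szero >] = false by apply/asboolPn => /GIn; apply.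
have gex : exists a, `[< G a >].
  by have [a Ga] := sfilter_ex Gf; exists a; apply/asboolP.
exists (Point gI gU g0 gex); split => /=.
- by move=> a /FG Ga; apply/asboolP.
- by move=> a Ia; apply/asboolPn => /GIn; apply.
- by move=> c /asboolPn /Gmax[f Gf' fc]; exists f => //; apply/asboolP.
Qed.

(** The sections a and b agree on the cone of w minus the cone of c. *)
Definition agree a b w c := (a ⊓ w) ⊔ c = (b ⊓ w) ⊔ c.

Lemma agree_refine a b w c w' c' : w' ⊑ w -> c ⊑ c' ->
  agree a b w c -> agree a b w' c'.
Proof.
rewrite /agree => ww cc e.
have E d : (d ⊓ w') ⊔ c' = ((d ⊓ w) ⊔ c) ⊓ w' ⊔ c'.
  rewrite smeetUl meetAC -(smeetA d) ww -sjoinA; congr (_ ⊔ _).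
  by rewrite below_join //; apply: below_trans cc; apply: below_meetl.
by rewrite (E a) (E b) e.
Qed.

Definition germeq x a b := exists w c, [/\ x w, ~~ x c & agree a b w c].

Lemma germeq_refl x a : germeq x a a.
Proof. by have [w xw] := pt_ex x; exists w, szero; rewrite pt0. Qed.

Lemma germeq_sym x a b : germeq x a b -> germeq x b a.
Proof. by move=> [w [c [? ? ?]]]; exists w, c. Qed.

Lemma germeq_trans x b a d : germeq x a b -> germeq x b d -> germeq x a d.
Proof.
move=> [w [c [xw xc e]]] [w' [c' [xw' xc' e']]]; exists (w ⊓ w'), (c ⊔ c').
split; first by rewrite ptI xw.
  by rewrite ptU negb_or xc.
rewrite /agree (agree_refine _ _ e) ?(agree_refine _ _ e') //.
- exact: below_meetr.
- exact: below_joinr.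
- exact: below_meetl.
- exact: below_joinl.
Qed.

Lemma germeq_meetl x a b : x b -> germeq x (a ⊓ b) a.
Proof.
by move=> xb; exists b, szero; rewrite pt0 xb /agree -smeetA smeetxx.
Qed.

Lemma germeq_joinr x a b : x b -> germeq x (a ⊔ b) b.
Proof.
by move=> xb; exists b, szero; rewrite pt0 xb /agree sjoinIK smeetxx.
Qed.

Lemma germeq_joinl x a b : x a -> ~~ x b -> germeq x (a ⊔ b) a.
Proof.
move=> xa xb; exists a, b; split=> //.
by rewrite /agree smeetUl smeetxx -sjoinA join_meetK.
Qed.

(** The germ of a at x, as an equivalence class of elements defined at x; it
    is empty when a is not defined at x, so that [class a] records the domain
    of a as well as its values. *)
Definition class a x : set S := [set b | [/\ x a, x b & germeq x a b]].

Lemma class_out a x : ~~ x a -> class a x = set0.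
Proof. by move=> xa; rewrite -subset0 => b [xa']; rewrite xa' in xa. Qed.

Lemma class_self a x : x a -> class a x a.
Proof. by move=> xa; split=> //; exact: germeq_refl. Qed.

Lemma class_germeq a b x : x a -> x b -> germeq x a b -> class a x = class b x.
Proof.
move=> xa xb ab; apply/seteqP; split=> d [_ xd e]; split=> //.
  exact: germeq_trans (germeq_sym ab) e.
exact: germeq_trans ab e.
Qed.

Lemma class_meet a b x : class (a ⊓ b) x = if x b then class a x else set0.
Proof.
have [xb|xb] := boolP (x b); last by rewrite class_out // ptI (negbTE xb) andbF.
have [xa|xa] := boolP (x a); last by rewrite !class_out // ptI (negbTE xa).
by apply: class_germeq; rewrite ?ptI ?xa //; exact: germeq_meetl.
Qed.

(** In a join, the right-hand section takes precedence. *)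
Lemma class_join a b x : class (a ⊔ b) x = if x b then class b x else class a x.
Proof.
have [xb|xb] := boolP (x b).
  by apply: class_germeq; rewrite ?ptU ?xb ?orbT //; exact: germeq_joinr.
have [xa|xa] := boolP (x a).
  by apply: class_germeq; rewrite ?ptU ?xa //; exact: germeq_joinl.
by rewrite !class_out // ptU negb_or xa.
Qed.

(** Half of injectivity. The ideal J collects the elements on whose cone a and
    b coincide; a point containing a and maximal for J would have a
    neighborhood on which a and b agree, and then contain a member of J. *)
Lemma class_eq_below a b : class a = class b -> a = b ⊓ a.
Proof.
move=> ab.
have abx x : x a -> x b /\ germeq x a b.
  by move=> /class_self; rewrite ab => -[xb xa] /germeq_sym.
pose J : set S := [set w | a ⊓ w = b ⊓ w].
have Ji : sideal J.
  split=> [u v uv|u v]; rewrite /J /= => eu; last by move=> ev; rewrite !smeetUr eu ev.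
  by rewrite -uv !smeetA meetAC eu meetAC.
have J0 : J szero by rewrite /J /= !smeetx0.
have F0 : sfilter [set y | a ⊑ y].
  split; first by exists a; exact: below_refl.
    by move=> u v uv au; apply: below_trans uv.
  by move=> u v; exact: below_meet.
apply: contrapT => nab.
have [|x [xF xJ xmax]] := point_maximal F0 Ji J0.
  rewrite -subset0 => y [/= ay /(sideal_down Ji ay)].
  by rewrite /J /= smeetxx.
have xa : x a by apply: xF; exact: below_refl.
have [xb [w [c [xw xc e]]]] := abx x xa.
have [f xf fc] := xmax c xc.
(* On the cone of v, which lies in those of a and b, the two sections agree
   both on c (because f ⊓ c is in J) and off c (because v is below w). *)
pose v := w ⊓ (f ⊓ a ⊓ b).
suff Jv : J v by have := xJ v Jv; rewrite /= !ptI xw xf xa xb.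
have va : v ⊑ a.
  apply: below_trans (below_meetr _ _) _; apply: below_trans (below_meetl _ _) _.
  exact: below_meetr.
have vb : v ⊑ b.
  by apply: below_trans (below_meetr _ _) _; exact: below_meetr.
apply: (join_meet_cancel (c := c)).
- apply: below_meet; last exact: below_meetr.
  exact: below_trans (below_meetr _ _) vb.
- apply: below_meet; last exact: below_meetr.
  exact: below_trans (below_meetr _ _) va.
- rewrite -(smeetA a) -(smeetA b); suff : J (v ⊓ c) by [].
  apply: (sideal_down Ji) fc; apply: below_meet2 _ (below_refl _).
  apply: below_trans (below_meetr _ _) _; apply: below_trans (below_meetl _ _) _.
  exact: below_meetl.
- by apply: agree_refine e; [exact: below_meetl|exact: below_refl].
Qed.

Lemma class_inj : injective class.
Proof.
move=> a b ab; have ea := class_eq_below ab.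
have eb := class_eq_below (esym ab).
by rewrite [RHS]eb -smeet_left -eb -ea.
Qed.

End Points.

(** * The spectrum as a local Priestley space *)

HB.instance Definition _ (S : sdlType) := gen_eqMixin (point S).
HB.instance Definition _ (S : sdlType) := gen_choiceMixin (point S).

Section PointTopology.
Variable S : sdlType.
Implicit Types (a b c w : S) (x y : point S).

Definition box w c : set (point S) := [set x : point S | x w /\ ~~ x c].

Definition box_open (U : set (point S)) :=
  forall x, U x -> exists w c, box w c x /\ box w c `<=` U.

Let box_openT : box_open setT.
Proof. by move=> x _; have [w xw] := pt_ex x; exists w, szero; rewrite /box /= pt0. Qed.

Let box_openI : setI_closed box_open.
Proof.
move=> U V oU oV x [/oU[w [c [[xw xc] wU]]] /oV[w' [c' [[xw' xc'] wV]]]].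
exists (w ⊓ w'), (c ⊔ c'); split; first by rewrite /box /= ptI ptU xw xw' negb_or xc.
move=> y []; rewrite ptI ptU negb_or => /andP[? ?] /andP[? ?].
by split; [apply: wU|apply: wV].
Qed.

Let box_open_bigU (I : Type) (f : I -> set (point S)) :
  (forall i, box_open (f i)) -> box_open (\bigcup_i f i).
Proof.
move=> of_ x [i _ /of_[w [c [xwc wcf]]]]; exists w, c; split=> // y /wcf fy.
by exists i.
Qed.

HB.instance Definition _ :=
  isOpenTopological.Build (point S) box_openT box_openI box_open_bigU.

Lemma openP (U : set (point S)) :
  open U <-> forall x, U x -> exists w c, box w c x /\ box w c `<=` U.
Proof. by []. Qed.

Lemma open_box w c : open (box w c).
Proof. by move=> x xwc; exists w, c; split=> // y. Qed.

Lemma nbhs_boxP x (U : set (point S)) :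
  nbhs x U <-> exists w c, box w c x /\ box w c `<=` U.
Proof.
split=> [|[w [c [xwc wcU]]]]; last first.
  by apply: filterS wcU _; apply: open_nbhs_nbhs; split=> //; exact: open_box.
rewrite nbhsE => -[V [oV Vx] VU]; have [w [c [xwc wcV]]] := (openP V).1 oV x Vx.
by exists w, c; split=> //; apply: subset_trans VU.
Qed.

Definition cone a : set (point S) := [set x : point S | x a].

Lemma open_cone a : open (cone a).
Proof.
apply/openP => x xa; exists a, szero; split; first by rewrite /box /= pt0.
by move=> y [].
Qed.

Lemma open_coneC a : open (~` cone a).
Proof.
apply/openP => x /negP xa; have [w xw] := pt_ex x; exists w, a; split=> //.
by move=> y [_ /negP].
Qed.

Lemma closed_cone a : closed (cone a).
Proof. by rewrite -openC; exact: open_coneC. Qed.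

(** The limit of an ultrafilter of points is the prime filter of the elements
    whose cones belong to the ultrafilter; it contains a, hence is nonzero. *)
Lemma compact_cone a : compact (cone a).
Proof.
rewrite compact_ultra => F FU Fa.
have FP : ProperFilter F := @ultra_proper _ F FU.
have FF : Filter F := @filter_filter _ F FP.
have gI b c : `[< F (cone (b ⊓ c)) >] = `[< F (cone b) >] && `[< F (cone c) >].
  apply/asboolP/andP => [Fbc|[/asboolP Fb /asboolP Fc]].
    split; apply/asboolP; apply: (filterS _ Fbc) => x; rewrite /cone /= ptI.
      by case/andP.
    by case/andP.
  by apply: (filterS _ (filterI Fb Fc)) => x []; rewrite /cone /= ptI => -> ->.
have gU b c : `[< F (cone (b ⊔ c)) >] = `[< F (cone b) >] || `[< F (cone c) >].
  apply/asboolP/orP => [Fbc|[] /asboolP]; last 2 first.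
  - by apply: filterS => x; rewrite /cone /= ptU => ->.
  - by apply: filterS => x; rewrite /cone /= ptU => ->; rewrite orbT.
  have [Fb|Fb] := in_ultra_setVsetC (cone b) FU; first by left; apply/asboolP.
  right; apply/asboolP; apply: (filterS _ (filterI Fbc Fb)) => x [].
  by rewrite /cone /= ptU => /orP[].
have g0 : `[< F (cone szero) >] = false.
  apply/asboolPn; have -> : cone szero = set0; last exact: filter_not_empty.
  by rewrite -subset0 => x; rewrite /cone /= pt0.
have gex : exists b, `[< F (cone b) >] by exists a; apply/asboolP.
exists (Point gI gU g0 gex); split; first exact/asboolP.
move=> U /nbhs_boxP[w [c [[/asboolP Fw /asboolPn Fc] wcU]]].
have {}Fc : F (~` cone c) by have [] := in_ultra_setVsetC (cone c) FU.
by apply: (filterS _ (filterI Fw Fc)) => x [xw xc]; apply: wcU; split=> //; exact/negP.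
Qed.

(** Reverse inclusion of prime filters, that is, inclusion of prime ideals: it
    makes cones downsets, and the point at infinity, added as a maximum,
    plays the part of the improper ideal. *)
Definition pt_le x y := `[< forall a, y a -> x a >].

Let pt_le_refl : reflexive pt_le. Proof. by move=> x; apply/asboolP. Qed.

Let pt_le_anti : antisymmetric pt_le.
Proof.
move=> x y /andP[/asboolP xy /asboolP yx]; apply: pt_inj => a.
by apply/idP/idP; [exact: yx|exact: xy].
Qed.

Let pt_le_trans : transitive pt_le.
Proof.
move=> y x z /asboolP xy /asboolP yz; apply/asboolP => a /yz; exact: xy.
Qed.

HB.instance Definition _ := Order.Le_isPOrder.Build (Order.Disp tt tt) (point S)
  pt_le_refl pt_le_anti pt_le_trans.

Lemma pt_leP x y : reflect (forall a, y a -> x a) (x <= y)%O.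
Proof. exact: asboolP. Qed.

Lemma downset_cone a : is_downset (cone a).
Proof. by move=> x y /pt_leP xy; exact: xy. Qed.

Local Notation opc := (one_point_compactification (point S)).

Lemma open_Some_coneC a : open (~` (Some @` cone a) : set opc).
Proof.
rewrite openE => -[x|] xa; rewrite /interior.
  have : nbhs x (~` cone a).
    by apply: open_nbhs_nbhs; split; [exact: open_coneC|move=> ax; apply: xa; exists x].
  move/one_point_compactification_some_nbhs; apply: filterS => _ [y ya <-] [z za [zy]].
  by apply: ya; rewrite -zy.
exists (cone a); first by split; [exact: compact_cone|exact: closed_cone].
by move=> _ [[y ya <-] [z za [zy]]|-> [z]//]; apply: ya; rewrite -zy.
Qed.

(** Points are separated by the image of a cone, a clopen downset of the
    compactification, and its complement. *)
Lemma pt_priestley : priestley_space opc.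
Proof.
split; first exact: one_point_compactification_compact.
have sep (x : opc) (y : point S) a : (forall z, x = Some z -> ~ z a) -> y a ->
    exists U V : set opc, [/\ clopen U, clopen V, U `&` V = set0 &
      [/\ is_upset U, is_downset V, U x & V (Some y)]].
  move=> xa ya; exists (~` (Some @` cone a)), (Some @` cone a).
  have oV : open (Some @` cone a : set opc).
    by apply: one_point_compactification_open_some; exact: open_cone.
  split.
  - by split; [exact: open_Some_coneC|exact: open_closedC].
  - by split=> //; rewrite -openC; exact: open_Some_coneC.
  - exact: setICl.
  split; last by exists y.
  - move=> u v uv ua [z za zv]; apply: ua; move: uv; rewrite -zv.
    by case: u => // u uz; exists u => //; apply: downset_cone uz za.
  - by move=> u v uv [z za zv]; move: uv; rewrite -zv; case: u => // u uz;
      exists u => //; apply: downset_cone uz za.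
  - by move=> [z za zx]; exact: xa za.
case=> [x|] [y|] //.
- move=> nxy; have /existsNP[a /not_implyP[ya xa]] : ~ forall a, y a -> x a.
    by move=> xy; move/negP: nxy; apply; apply/pt_leP.
  by apply: sep ya => z [<-].
- by have [a ya] := pt_ex y => _; apply: sep ya.
Qed.

Definition spectrum : lpsType := LpsType pt_priestley.

End PointTopology.

(** * The sheaf of classes *)

Section ClassSheaf.
Variable S : sdlType.
Implicit Types (a b c w : S) (x y : point S) (s t : point S -> set S).
Implicit Types U V W : opens (point S).

(** Sections are total functions that are empty outside their domain; then
    equality of sections, and even of sections over different open sets, is
    equality of functions. *)
Definition is_section U s :=
  (forall x, ~ opens_set U x -> s x = set0) /\
  (forall x, opens_set U x -> exists2 a, x a & \forall y \near x, s y = class a y).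

Lemma section_supp U s x : is_section U s -> opens_set U x <-> s x !=set0.
Proof.
move=> [sout sin]; split=> [/sin[a xa /nbhs_singleton ->]|[b sb]].
  by exists a; exact: class_self.
by apply: contrapT => /sout s0; rewrite s0 in sb.
Qed.

Definition restrict (V : set (point S)) s : point S -> set S :=
  fun x => if pselect (V x) then s x else set0.

Lemma restrict_in (V : set (point S)) s x : V x -> restrict V s x = s x.
Proof. by rewrite /restrict; case: pselect. Qed.

Lemma restrict_out (V : set (point S)) s x : ~ V x -> restrict V s x = set0.
Proof. by rewrite /restrict; case: pselect. Qed.

Lemma restrict_section U V s : V `<=` U -> is_section U s ->
  is_section V (restrict V s).
Proof.
move=> VU [_ sin]; split=> x Vx; first exact: restrict_out.
have [a xa sa] := sin x (VU x Vx); exists a => //.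
have Vnbhs : nbhs x V by apply: open_nbhs_nbhs; split=> //; exact: opens_open.
by apply: (filterS _ (filterI sa Vnbhs)) => y [say Vy]; rewrite restrict_in.
Qed.

Definition class_restr U V (VU : V `<=` U) (s : {s | is_section U s}) :
    {s | is_section V s} :=
  exist _ (restrict V (sval s)) (restrict_section VU (svalP s)).

Lemma section_eq U (s t : {s | is_section U s}) :
  (forall x, opens_set U x -> sval s x = sval t x) -> s = t.
Proof.
case: s t => [s sP] [t tP] /= st.
have E : s = t.
  apply/funext => x; have [Ux|Ux] := pselect (opens_set U x); first exact: st.
  by rewrite sP.1 // tP.1.
by subst t; congr exist; exact: Prop_irrelevance.
Qed.

Lemma class_restr_id U (UU : U `<=` U) (s : {s | is_section U s}) : class_restr UU s = s.
Proof. by apply: section_eq => x Ux /=; rewrite restrict_in. Qed.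

Lemma class_restr_comp U V W (VU : V `<=` U) (WV : W `<=` V) (WU : W `<=` U)
    (s : {s | is_section U s}) :
  class_restr WV (class_restr VU s) = class_restr WU s.
Proof.
by apply: section_eq => x Wx /=; rewrite !restrict_in //; exact: WV.
Qed.

Definition class_presheaf : presheaf (point S) :=
  Presheaf class_restr_id class_restr_comp.

Lemma class_sheaf_axiom : sheaf_axiom class_presheaf.
Proof.
move=> I U W WU s cov comp.
have sE i j x : opens_set (W i) x -> opens_set (W j) x ->
    sval (s i) x = sval (s j) x.
  move=> Wi Wj; have /(congr1 sval)/(congr1 (@^~ x)) /= := comp i j.
  by rewrite !restrict_in.
pose t x : set S := [set b | exists2 i, opens_set (W i) x & sval (s i) x b].
have tE i x : opens_set (W i) x -> t x = sval (s i) x.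
  move=> Wx; apply/seteqP; split=> [b [j Wj sb]|b sb]; last by exists i.
  by rewrite (sE i j).
have tP : is_section U t.
  split=> x Ux.
    by rewrite -subset0 => b [i Wx _]; apply: Ux; exact: WU Wx.
  have [i _ Wx] := cov x Ux; have [a xa sa] := (svalP (s i)).2 x Wx.
  exists a => //.
  have Wnbhs : nbhs x (W i) by apply: open_nbhs_nbhs; split=> //; exact: opens_open.
  by apply: (filterS _ (filterI sa Wnbhs)) => y [say Wy]; rewrite (tE i).
exists (exist _ t tP); split.
  by move=> i; apply: section_eq => x Wx /=; rewrite restrict_in // (tE i).
move=> t' t'E; apply: section_eq => x Ux /=.
have [i _ Wx] := cov x Ux; rewrite (tE i) // -(t'E i) /=.
by rewrite restrict_in.
Qed.

Definition cone_opens a : opens (point S) := Opens (@open_cone S a).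

Lemma class_is_section a : is_section (cone_opens a) (class a).
Proof.
split=> x xa; first by apply: class_out; apply/negP.
by exists a; [exact: xa|apply: (@nearW _ (nbhs x))].
Qed.

Lemma class_global_support x : inhabited (stalk class_presheaf x).
Proof.
have [a xa] := pt_ex x.
have aP := class_is_section a.
by constructor; apply: (@germ _ class_presheaf x (cone_opens a) xa (exist _ _ aP)).
Qed.

Definition class_sheaf : gsheaf (spectrum S) :=
  @Gsheaf (spectrum S) class_presheaf class_sheaf_axiom class_global_support.

(** * The representation map *)

Local Notation T := (dual class_sheaf).

Definition dual_sec (p : T) : point S -> set S := sval (tagged p).

(** The domain of a section can be read off from the function, as the set of
    points where it is nonempty. *)
Lemma dual_sec_inj : injective dual_sec.
Proof.
move=> [U [s sP]] [V [t tP]] /= st; rewrite /dual_sec /= in st; subst t.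
have UV : U = V.
  by apply/codownset_eq/seteqP; split=> x;
    [move/(section_supp x sP)/(section_supp x tP)
    |move/(section_supp x tP)/(section_supp x sP)].
by subst V; congr existT; congr exist; exact: Prop_irrelevance.
Qed.

Lemma dual_sec_supp (p : T) x : opens_set (tag p) x <-> dual_sec p x !=set0.
Proof. exact: section_supp (svalP (tagged p)). Qed.

Lemma dual_sec_meet (p q : T) x :
  opens_set (tag q) x -> dual_sec (p ⊓ q) x = dual_sec p x.
Proof.
move=> qx; have [px|px] := pselect (opens_set (tag p) x).
  by rewrite /dual_sec /= restrict_in.
rewrite /dual_sec /= restrict_out; first by rewrite (svalP (tagged p)).1.
by case.
Qed.

Lemma dual_sec_meet_out (p q : T) x :
  ~ opens_set (tag q) x -> dual_sec (p ⊓ q) x = set0.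
Proof. by move=> qx; rewrite /dual_sec /= restrict_out // => -[]. Qed.

Lemma dual_sec_joinr (p q : T) x :
  opens_set (tag q) x -> dual_sec (p ⊔ q) x = dual_sec q x.
Proof.
move=> qx; have /(congr1 sval)/(congr1 (@^~ x)) /= := patchr (tagged p) (tagged q).
by rewrite restrict_in.
Qed.

Lemma dual_sec_joinl (p q : T) x :
  ~ opens_set (tag q) x -> dual_sec (p ⊔ q) x = dual_sec p x.
Proof.
move=> qx; have [px|px] := pselect (opens_set (tag p) x).
  have /(congr1 sval)/(congr1 (@^~ x)) /= := patchl (tagged p) (tagged q).
  by rewrite !restrict_in.
rewrite /dual_sec (svalP (tagged (p ⊔ q))).1; last by case.
by rewrite (svalP (tagged p)).1.
Qed.

Definition cone_codownset a : codownset (spectrum S) :=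
  @Codownset (spectrum S) (cone_opens a) (@compact_cone S a) (@downset_cone S a).

Definition represent a : T :=
  existT _ (cone_codownset a) (exist _ (class a) (class_is_section a)).

Lemma dual_sec_represent a : dual_sec (represent a) = class a.
Proof. by []. Qed.

Lemma representI a b : represent (a ⊓ b) = represent a ⊓ represent b.
Proof.
apply: dual_sec_inj; apply/funext => x; rewrite dual_sec_represent class_meet.
by case: ifPn => xb; [rewrite dual_sec_meet|rewrite dual_sec_meet_out //; exact/negP].
Qed.

Lemma representU a b : represent (a ⊔ b) = represent a ⊔ represent b.
Proof.
apply: dual_sec_inj; apply/funext => x; rewrite dual_sec_represent class_join.
by case: ifPn => xb; [rewrite dual_sec_joinr|rewrite dual_sec_joinl //; exact/negP].
Qed.

Lemma represent0 : represent szero = szero.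
Proof.
apply: dual_sec_inj; apply/funext => x; rewrite dual_sec_represent.
rewrite class_out ?pt0 //; apply/esym.
by apply: contrapT => /eqP/set0P/dual_sec_supp.
Qed.

Lemma represent_inj : injective represent.
Proof. by move=> a b /(congr1 dual_sec)/class_inj. Qed.

(** No condition is imposed outside the cone of a: such elements are partial
    solutions to representing s, and can be joined. *)
Definition represents s a := forall x, x a -> s x = class a x.

Lemma represents_join s a b : represents s a -> represents s b ->
  represents s (a ⊔ b).
Proof.
move=> sa sb x; rewrite ptU class_join; case: ifPn => [xb _|_]; first exact: sb.
by rewrite orbF; exact: sa.
Qed.

(** Every point of U lies in a cone on which s is represented. Otherwise a
    point y below x is maximal for the ideal I of partial solutions; s is given
    near y by some a on a box, and overwriting a there by a partial solution on
    the missing part produces a partial solution at y. That y is still in U is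
    where U being a downset is needed. *)
Lemma represents_point U s x : is_section U s -> is_downset U -> opens_set U x ->
  exists2 a, represents s a & x a.
Proof.
move=> sP dU Ux; apply: contrapT => nex.
pose I : set S := [set c | exists2 a, represents s a & c ⊑ a].
have Ii : sideal I.
  split=> [c d cd [a sa da]|c d [a sa ca] [b sb db]].
    by exists a => //; exact: below_trans da.
  exists (a ⊔ b); first exact: represents_join.
  rewrite /below smeetUl.
  rewrite (below_trans ca (below_joinl a b)).
  by rewrite (below_trans db (below_joinr a b)).
have I0 : I szero.
  by exists szero; [move=> y; rewrite pt0|exact: below_refl].
have [|y [xy yI ymax]] := point_maximal (pt_sfilter x) Ii I0.
  rewrite -subset0 => c [/= xc [a sa ca]]; apply: nex; exists a => //.
  exact: pt_below xc.
have Uy : opens_set U y by apply: dU Ux; apply/pt_leP => a xa; exact: xy.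
have [a ya /nbhs_boxP[w [c [[yw yc] wcs]]]] := sP.2 y Uy.
have [f yf [g sg fcg]] := ymax c yc.
have /yI : I (a ⊓ w ⊓ f).
  exists (a ⊓ w ⊓ f ⊔ g); last exact: below_joinl.
  move=> z; rewrite ptU class_join; case: ifPn => [zg _|zg]; first exact: sg.
  rewrite orbF !ptI => /andP[/andP[za zw] zf].
  rewrite !class_meet zw zf; apply: wcs; split=> //.
  by apply: contra zg => zc; apply: (pt_below fcg); rewrite ptI zf.
by rewrite /= !ptI ya yw yf.
Qed.

Lemma represent_surj (p : T) : exists a, represent a = p.
Proof.
have sP : is_section (tag p) (dual_sec p) := svalP (tagged p).
have pex x : opens_set (tag p) x -> exists2 a, represents (dual_sec p) a & x a.
  by apply: represents_point sP _; exact: (@codownset_downset _ (tag p)).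
(* The elements that represent p are directed under joins, so compactness can
   be used along the filter G of their upper sections. *)
pose R : set S := [set a | represents (dual_sec p) a].
have R0 : R szero by move=> x; rewrite pt0.
pose G := filter_from R (fun a => [set b | R b /\ a ⊑ b]).
have GF : Filter G.
  apply: filter_from_filter; first by exists szero.
  move=> a b Ra Rb; exists (a ⊔ b); first exact: represents_join.
  move=> d [Rd abd]; split; split=> //; apply: below_trans abd.
    exact: below_joinl.
  exact: below_joinr.
have /compact_near_coveringP cU : @compact (point S) (opens_set (tag p)).
  exact: (@codownset_compact _ (tag p)).
have [|a Ra aU] := cU _ G (fun a x => x a) GF.
  move=> x /pex[a Ra xa]; exists (cone a, [set b | R b /\ a ⊑ b]).
    split; last by exists a.
    by apply: open_nbhs_nbhs; split; first exact: open_cone.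
  by move=> [y b] [/= ya [_ ab]]; apply: pt_below ab ya.
have {}aU : opens_set (tag p) `<=` cone a.
  by apply: aU; split=> //; exact: below_refl.
exists a; apply: dual_sec_inj; apply/funext => x; rewrite dual_sec_represent.
have [xa|xa] := boolP (x a); first by rewrite Ra.
rewrite class_out //; apply/esym; apply: contrapT => /eqP/set0P/dual_sec_supp/aU.
exact/negP.
Qed.

End ClassSheaf.

(** The inverse map is automatically a homomorphism, and surjectivity makes
    both maps proper. *)
Lemma bijective_sdl_isomorphic (S T : sdlType) (f : skewHom S T) :
  injective f -> (forall t, exists s, f s = t) -> sdl_isomorphic S T.
Proof.
move=> fI fS; pose g t := sval (cid (fS t)).
have fg t : f (g t) = t := svalP (cid (fS t)).
have gf s : g (f s) = s by apply: fI.
have gI x y : g (x ⊓ y) = g x ⊓ g y by apply: fI; rewrite skew_homI !fg.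
have gU x y : g (x ⊔ y) = g x ⊔ g y by apply: fI; rewrite skew_homU !fg.
have g0 : g szero = szero by rewrite -(skew_hom0 f) gf.
have proper (S1 T1 : sdlType) (h : skewHom S1 T1) (k : T1 -> S1) :
    (forall t, h (k t) = t) -> proper_map (induced h).
  move=> hk c; exists (piD (k (reprD c))).
  by rewrite induced_piD hk reprDK.
exists (SdlHom (proper _ _ f g fg)).
by exists (SdlHom (proper _ _ (SkewHom gI gU g0) f gf)).
Qed.

Theorem proposition7p7 (S : sdlType) :
  exists (X : lpsType) (E : gsheaf X), sdl_isomorphic S (dual E).
Proof.
exists (spectrum S), (class_sheaf S).
apply: (bijective_sdl_isomorphic (f := SkewHom (@representI S) (@representU S)
  (@represent0 S))); [exact: represent_inj|exact: represent_surj].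
Qed.
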